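(* Let $\mathcal{R}$ be a commutative ring with unity, $\mathcal{A}$ a unital $\mathcal{R}$-algebra and $\mathcal{M}$ a unital $\mathcal{A}$-bimodule. Consider the two maps $\widehat{\pi}_{\mathcal{A}}: h^1(\mathcal{A}\ltimes\mathcal{M})\to H^1(\mathcal{A})$, $\widehat{\pi}_{\mathcal{A}}([(d,S)])=[d]$, and $\widehat{\Phi}: H^1_{\mathcal{A}}(\mathcal{M})\to h^1(\mathcal{A}\ltimes\mathcal{M})$, $\widehat{\Phi}([S])=[(0,S)]$. The maps $\widehat{\pi}_{\mathcal{A}}$ and $\widehat{\Phi}$ are well defined group homomorphisms. Moreover, the following sequence of group homomorphisms is exact: $$0\longrightarrow H^1_{\mathcal{A}}(\mathcal{M})\xrightarrow{\ \widehat{\Phi}\ } h^1(\mathcal{A}\ltimes\mathcal{M})\xrightarrow{\ \widehat{\pi}_{\mathcal{A}}\ } H^1(\mathcal{A}).$$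
   Context: $\mathcal{A}\ltimes\mathcal{M}$ is the trivial extension algebra: $\mathcal{A}\times\mathcal{M}$ with componentwise addition and scalar multiplication and product $(a,m)(b,n)=(ab,an+mb)$. $H^1(\mathcal{A})=\mathrm{Der}(\mathcal{A})/\mathrm{Innder}(\mathcal{A})$, where $\mathrm{Der}(\mathcal{A})$ is the additive group of $\mathcal{R}$-linear derivations of $\mathcal{A}$ and $\mathrm{Innder}(\mathcal{A})$ the subgroup of inner ones $[a_0,-]:a\mapsto a_0a-aa_0$. For $d\in\mathrm{Der}(\mathcal{A})$, an $\mathcal{R}$-linear map $S:\mathcal{M}\to\mathcal{M}$ is a module generalized $d$-derivation if $S(am)=aS(m)+d(a)m$ and $S(ma)=S(m)a+md(a)$ for all $a\in\mathcal{A}$, $m\in\mathcal{M}$. $\mathrm{der}(\mathcal{A}\ltimes\mathcal{M})$ is the additive group of derivations of $\mathcal{A}\ltimes\mathcal{M}$ of the form $(d,S):(a,m)\mapsto(d(a),S(m))$, where $d\in\mathrm{Der}(\mathcal{A})$ and $S$ is a module generalized $d$-derivation; $\mathrm{innder}(\mathcal{A}\ltimes\mathcal{M})$ is its subgroup of inner derivations of the form $[(a_0,0),-]:(a,m)\mapsto(a_0a-aa_0,\,a_0m-ma_0)$ with $a_0\in\mathcal{A}$. The restricted first cohomology group is $h^1(\mathcal{A}\ltimes\mathcal{M})=\mathrm{der}(\mathcal{A}\ltimes\mathcal{M})/\mathrm{innder}(\mathcal{A}\ltimes\mathcal{M})$. $H^1_{\mathcal{A}}(\mathcal{M})=\mathrm{End}_{\mathcal{A}-\mathcal{A}}(\mathcal{M})/\mathrm{Innbi}_{\mathcal{A}}(\mathcal{M})$,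 where $\mathrm{End}_{\mathcal{A}-\mathcal{A}}(\mathcal{M})$ is the additive group of $\mathcal{A}$-bimodule homomorphisms $\mathcal{M}\to\mathcal{M}$ and $\mathrm{Innbi}_{\mathcal{A}}(\mathcal{M})$ is the subgroup of central inner ones, i.e. those of the form $m\mapsto a_0m-ma_0$ with $a_0$ in the center $Z(\mathcal{A})$. Square brackets around a single element denote its class in the relevant quotient group. *)

(* Defs.v *)
From HB Require Import structures.
From mathcomp Require Import all_boot all_algebra.
From mathcomp Require Import all_classical.

Set Implicit Arguments.
Unset Strict Implicit.
Unset Printing Implicit Defensive.

Import GRing.Theory.

Local Open Scope ring_scope.
Local Open Scope quotient_scope.

Reserved Notation "a *l: m" (at level 40, left associativity).
Reserved Notation "m *r: a" (at level 40, left associativity).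

(* Unital associative algebras over R.  Unlike [algType R], this structure does
   not exclude the zero algebra.  Hierarchy-Builder does not allow a structure
   above [pzRingType] and [lmodType R] to be added after [lSemiAlgType R], so the
   scaling is a field here, and the [lmodType R] structure is an instance. *)
HB.mixin Record isPzAlgebra (R : comPzRingType) A of GRing.PzRing A := {
  pzscale : R -> A -> A;
  pzscaleA : forall k l a, pzscale k (pzscale l a) = pzscale (k * l) a;
  pzscale1 : left_id 1 pzscale;
  pzscaleDr : right_distributive pzscale +%R;
  pzscaleDl : forall a, {morph pzscale^~ a : k l / k + l};
  pzscaleAl : forall k a b, pzscale k (a * b) = pzscale k a * b;
  pzscaleAr : forall k a b, pzscale k (a * b) = a * pzscale k b
}.

#[short(type="pzAlgType")]
HB.structure Definition PzAlgebra (R : comPzRingType) :=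
  {A of GRing.PzRing A & isPzAlgebra R A}.

#[non_forgetful_inheritance]
HB.instance Definition _ (R : comPzRingType) (A : pzAlgType R) :=
  GRing.Zmodule_isLmodule.Build R (PzAlgebra.sort A)
    (@pzscaleA R A) (@pzscale1 R A) (@pzscaleDr R A) (@pzscaleDl R A).

HB.instance Definition _ (R : comPzRingType) (A : algType R) :=
  isPzAlgebra.Build R (GRing.Algebra.sort A)
    (@scalerA R A) (@scale1r R A) (@scalerDr R A) (fun a k l => scalerDl a k l)
    (@scalerAl R A) (@scalerAr R A).

Lemma pzscalerAl (R : comPzRingType) (A : pzAlgType R) (k : R) (a b : A) :
  k *: (a * b) = k *: a * b.
Proof. exact: pzscaleAl. Qed.

Lemma pzscalerAr (R : comPzRingType) (A : pzAlgType R) (k : R) (a b : A) :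
  k *: (a * b) = a * (k *: b).
Proof. exact: pzscaleAr. Qed.

(* Unital bimodules over the R-algebra A; both actions are compatible with one
   and the same R-module structure on M. *)
HB.mixin Record isBimodule (R : comPzRingType) (A : pzAlgType R) M
    of GRing.Lmodule R M := {
  lact : A -> M -> M;
  ract : M -> A -> M;
  lact1 : forall m, lact 1 m = m;
  lactA : forall a b m, lact (a * b) m = lact a (lact b m);
  lactDl : forall a b m, lact (a + b) m = lact a m + lact b m;
  lactDr : forall a m n, lact a (m + n) = lact a m + lact a n;
  lactZl : forall k a m, lact (k *: a) m = k *: lact a m;
  lactZr : forall k a m, lact a (k *: m) = k *: lact a m;
  ract1 : forall m, ract m 1 = m;
  ractA : forall m a b, ract m (a * b) = ract (ract m a) b;
  ractDl : forall m n a, ract (m + n) a = ract m a + ract n a;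
  ractDr : forall m a b, ract m (a + b) = ract m a + ract m b;
  ractZl : forall k m a, ract (k *: m) a = k *: ract m a;
  ractZr : forall k m a, ract m (k *: a) = k *: ract m a;
  lractA : forall a m b, ract (lact a m) b = lact a (ract m b)
}.

#[short(type="bimodType")]
HB.structure Definition Bimodule (R : comPzRingType) (A : pzAlgType R) :=
  {M of GRing.Lmodule R M & isBimodule R A M}.

Notation "a *l: m" := (lact a m) : ring_scope.
Notation "m *r: a" := (ract m a) : ring_scope.

Section BimoduleTheory.
Context {R : comPzRingType} {A : pzAlgType R} {M : bimodType A}.
Implicit Types (a b : A) (m n : M).

Lemma lact0 a : a *l: (0 : M) = 0.
Proof. by apply: (addIr (a *l: 0)); rewrite -lactDr !add0r. Qed.

Lemma lact0l m : (0 : A) *l: m = 0.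
Proof. by apply: (addIr (0 *l: m)); rewrite -lactDl !add0r. Qed.

Lemma ract0 a : (0 : M) *r: a = 0.
Proof. by apply: (addIr (0 *r: a)); rewrite -ractDl !add0r. Qed.

Lemma ract0r m : m *r: (0 : A) = 0.
Proof. by apply: (addIr (m *r: 0)); rewrite -ractDr !add0r. Qed.

Lemma lactN a m : a *l: (- m) = - (a *l: m).
Proof. by apply: (addIr (a *l: m)); rewrite -lactDr !addNr lact0. Qed.

Lemma lactNl a m : (- a) *l: m = - (a *l: m).
Proof. by apply: (addIr (a *l: m)); rewrite -lactDl !addNr lact0l. Qed.

Lemma ractN m a : (- m) *r: a = - (m *r: a).
Proof. by apply: (addIr (m *r: a)); rewrite -ractDl !addNr ract0. Qed.

Lemma ractNr m a : m *r: (- a) = - (m *r: a).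
Proof. by apply: (addIr (m *r: a)); rewrite -ractDr !addNr ract0r. Qed.

End BimoduleTheory.

Definition trivext (R : comPzRingType) (A : pzAlgType R) (M : bimodType A) :
  Type := (A * M)%type.

Section TrivialExtension.
Context {R : comPzRingType} {A : pzAlgType R} (M : bimodType A).

HB.instance Definition _ := GRing.Lmodule.copy (trivext M) (A * M)%type.

Definition trivext_one : trivext M := (1, 0).
Definition trivext_mul (x y : trivext M) : trivext M :=
  (x.1 * y.1, x.1 *l: y.2 + x.2 *r: y.1).

Lemma trivext_mulA : associative trivext_mul.
Proof.
move=> [a m] [b n] [c p]; congr (_, _); rewrite /= ?mulrA //.
by rewrite lactDr ractDl lactA ractA lractA addrA.
Qed.

Lemma trivext_mul1r : left_id trivext_one trivext_mul.
Proof. by case=> a m; rewrite /trivext_mul /= mul1r lact1 ract0 addr0. Qed.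

Lemma trivext_mulr1 : right_id trivext_one trivext_mul.
Proof. by case=> a m; rewrite /trivext_mul /= mulr1 ract1 lact0 add0r. Qed.

Lemma trivext_mulDl : left_distributive trivext_mul +%R.
Proof.
move=> [a m] [b n] [c p]; congr (_, _); rewrite /= ?mulrDl //.
by rewrite lactDl ractDl addrACA.
Qed.

Lemma trivext_mulDr : right_distributive trivext_mul +%R.
Proof.
move=> [a m] [b n] [c p]; congr (_, _); rewrite /= ?mulrDr //.
by rewrite lactDr ractDr addrACA.
Qed.

HB.instance Definition _ := GRing.Zmodule_isPzRing.Build (trivext M)
  trivext_mulA trivext_mul1r trivext_mulr1 trivext_mulDl trivext_mulDr.

Lemma trivext_scalerAl (k : R) (x y : trivext M) :
  k *: (x * y) = k *: x * y.
Proof.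
case: x y => [a m] [b n]; congr (_, _); rewrite /= ?pzscalerAl //.
by rewrite scalerDr lactZl ractZl.
Qed.

Lemma trivext_scalerAr (k : R) (x y : trivext M) :
  k *: (x * y) = x * (k *: y).
Proof.
case: x y => [a m] [b n]; congr (_, _); rewrite /= ?pzscalerAr //.
by rewrite scalerDr lactZr ractZr.
Qed.

HB.instance Definition _ := isPzAlgebra.Build R (trivext M)
  (@scalerA R (trivext M)) (@scale1r R (trivext M)) (@scalerDr R (trivext M))
  (fun x k l => scalerDl x k l) trivext_scalerAl trivext_scalerAr.

End TrivialExtension.

(* Membership predicates are made boolean with [asbool] so that the library's
   subgroups and quotients of abelian groups apply. *)

Section Derivations.
Context {R : comPzRingType}.

Definition derivation (A : pzAlgType R) (d : A -> A) : Prop :=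
  linear d /\ forall a b, d (a * b) = d a * b + a * d b.

Definition is_der (A : pzAlgType R) : {pred A -> A} :=
  fun d => `[< derivation d >].

Lemma is_der_zmod_closed A : zmod_closed (@is_der A).
Proof.
split=> [|f g /asboolP[fL fM] /asboolP[gL gM]]; apply/asboolP; split.
- by move=> k a b; rewrite scaler0 addr0.
- by move=> a b; rewrite mul0r mulr0 addr0.
- move=> k a b; rewrite -[LHS]/(f (k *: a + b) - g (k *: a + b)) fL gL.
  by rewrite scalerBr opprD addrACA.
- move=> a b; rewrite -[LHS]/(f (a * b) - g (a * b)) fM gM.
  by rewrite mulrBl mulrBr opprD addrACA.
Qed.

HB.instance Definition _ (A : pzAlgType R) :=
  GRing.isZmodClosed.Build (A -> A) (@is_der A) (@is_der_zmod_closed A).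

Record Der (A : pzAlgType R) :=
  MkDer { der_fun :> A -> A; _ : der_fun \in @is_der A }.

HB.instance Definition _ (A : pzAlgType R) := [isSub for @der_fun A].
HB.instance Definition _ (A : pzAlgType R) := [Choice of Der A by <:].
HB.instance Definition _ (A : pzAlgType R) := [SubChoice_isSubZmodule of Der A by <:].

Definition Innder (A : pzAlgType R) : {pred Der A} :=
  fun d => `[< exists a0 : A, forall a, d a = a0 * a - a * a0 >].

Lemma Innder_zmod_closed A : zmod_closed (@Innder A).
Proof.
split=> [|f g /asboolP[a0 fE] /asboolP[b0 gE]]; apply/asboolP.
- by exists 0 => a; rewrite mul0r mulr0 subrr.
- exists (a0 - b0) => a; rewrite -[LHS]/(f a - g a) fE gE.
  by rewrite mulrBl mulrBr !opprD !opprK addrACA.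
Qed.

HB.instance Definition _ (A : pzAlgType R) :=
  GRing.isZmodClosed.Build (Der A) (@Innder A) (@Innder_zmod_closed A).

Definition H1 (A : pzAlgType R) : zmodType := Quotient.quot (@Innder A).

End Derivations.

Section Restricted.
Context {R : comPzRingType} {A : pzAlgType R} (M : bimodType A).

Definition mod_gder (d : A -> A) (S : M -> M) : Prop :=
  [/\ linear S,
      forall a m, S (a *l: m) = a *l: S m + d a *l: m &
      forall m a, S (m *r: a) = S m *r: a + m *r: d a].

Definition is_rder : {pred Der (trivext M)} :=
  fun D => `[< exists (d : A -> A) (S : M -> M),
    [/\ derivation d, mod_gder d S &
        forall a m, D (a, m) = (d a, S m)] >].

Lemma mod_gderB d d' S S' :
  mod_gder d S -> mod_gder d' S' -> mod_gder (d - d') (S - S').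
Proof.
case=> SL Sl Sr [SL' Sl' Sr']; split.
- move=> k m n; rewrite -[LHS]/(S (k *: m + n) - S' (k *: m + n)) SL SL'.
  by rewrite scalerBr opprD addrACA.
- move=> a m; rewrite -[LHS]/(S (a *l: m) - S' (a *l: m)) Sl Sl'.
  by rewrite lactDr lactN lactDl lactNl opprD addrACA.
- move=> m a; rewrite -[LHS]/(S (m *r: a) - S' (m *r: a)) Sr Sr'.
  by rewrite ractDr ractNr ractDl ractN opprD addrACA.
Qed.

Lemma is_rder_zmod_closed : zmod_closed is_rder.
Proof.
split=> [|f g]; last first.
  move=> /asboolP[d [S [dd Sd fE]]] /asboolP[d' [S' [dd' Sd' gE]]].
  apply/asboolP; exists (d - d'), (S - S'); split.
  - apply/asboolP; have [_ /(_ d d')] := @is_der_zmod_closed R A.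
    by apply; apply/asboolP.
  - exact: mod_gderB.
  - by move=> a m; rewrite -[LHS]/(f (a, m) - g (a, m)) fE gE.
apply/asboolP; exists 0, 0; split=> //.
- by apply/asboolP; have [] := @is_der_zmod_closed R A.
- split=> [k m n|a m|m a]; first by rewrite scaler0 addr0.
  + by rewrite lact0 lact0l addr0.
  + by rewrite ract0 ract0r addr0.
Qed.

HB.instance Definition _ :=
  GRing.isZmodClosed.Build (Der (trivext M)) is_rder is_rder_zmod_closed.

Record rder :=
  MkRder { rder_der :> Der (trivext M); _ : rder_der \in is_rder }.

HB.instance Definition _ := [isSub for rder_der].
HB.instance Definition _ := [Choice of rder by <:].
HB.instance Definition _ := [SubChoice_isSubZmodule of rder by <:].

Definition rinnder : {pred rder} :=
  fun D => `[< exists a0 : A, forall x : trivext M,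
    D x = ((a0, 0) : trivext M) * x - x * ((a0, 0) : trivext M) >].

Lemma rinnder_zmod_closed : zmod_closed rinnder.
Proof.
split=> [|f g /asboolP[a0 fE] /asboolP[b0 gE]]; apply/asboolP.
- by exists 0 => a; rewrite mul0r mulr0 subrr.
- exists (a0 - b0) => x; rewrite -[LHS]/(f x - g x) fE gE.
  have -> : ((a0 - b0, 0) : trivext M) = ((a0, 0) : trivext M) - (b0, 0).
    by congr (_, _); rewrite subr0.
  by rewrite mulrBl mulrBr !opprD !opprK addrACA.
Qed.

HB.instance Definition _ :=
  GRing.isZmodClosed.Build rder rinnder rinnder_zmod_closed.

Definition h1 : zmodType := Quotient.quot rinnder.

Section Pair.
Context (d : Der A) (S : M -> M) (dS : mod_gder d S).

Definition pair_fun (x : trivext M) : trivext M := (d x.1, S x.2).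

Lemma pair_is_der : pair_fun \in @is_der R (trivext M).
Proof.
have /asboolP[dL dM] := valP d; have [SL Sl Sr] := dS; apply/asboolP; split.
  by move=> k [a m] [b n]; congr (_, _); rewrite /= ?dL ?SL.
move=> [a m] [b n]; congr (_, _); rewrite /= ?dM //.
have SD u v : S (u + v) = S u + S v.
  by rewrite -[u]scale1r SL !scale1r.
by rewrite SD Sl Sr [a *l: S n + _]addrC addrACA.
Qed.

Lemma pair_is_rder : MkDer pair_is_der \in is_rder.
Proof.
apply/asboolP; exists d, S; split=> //.
exact/asboolP/(valP d).
Qed.

Definition rder_pair : rder := MkRder pair_is_rder.

End Pair.

(* R-linearity follows from the other conditions and additivity, because
   k *: m = (k *: 1) *l: m. *)
Definition bimod_hom (S : M -> M) : Prop :=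
  [/\ linear S,
      forall a m, S (a *l: m) = a *l: S m &
      forall m a, S (m *r: a) = S m *r: a].

Definition is_bimod_end : {pred M -> M} := fun S => `[< bimod_hom S >].

Lemma is_bimod_end_zmod_closed : zmod_closed is_bimod_end.
Proof.
split=> [|S S' /asboolP[SL Sl Sr] /asboolP[SL' Sl' Sr']]; apply/asboolP; split.
- by move=> k m n; rewrite scaler0 addr0.
- by move=> a m; rewrite lact0.
- by move=> m a; rewrite ract0.
- move=> k m n; rewrite -[LHS]/(S (k *: m + n) - S' (k *: m + n)) SL SL'.
  by rewrite scalerBr opprD addrACA.
- move=> a m; rewrite -[LHS]/(S (a *l: m) - S' (a *l: m)) Sl Sl'.
  by rewrite lactDr lactN.
- move=> m a; rewrite -[LHS]/(S (m *r: a) - S' (m *r: a)) Sr Sr'.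
  by rewrite ractDl ractN.
Qed.

HB.instance Definition _ :=
  GRing.isZmodClosed.Build (M -> M) is_bimod_end is_bimod_end_zmod_closed.

Record BimodEnd :=
  MkBimodEnd { bimod_end_fun :> M -> M; _ : bimod_end_fun \in is_bimod_end }.

HB.instance Definition _ := [isSub for bimod_end_fun].
HB.instance Definition _ := [Choice of BimodEnd by <:].
HB.instance Definition _ := [SubChoice_isSubZmodule of BimodEnd by <:].

Definition Innbi : {pred BimodEnd} :=
  fun S => `[< exists2 a0 : A, (forall a, a0 * a = a * a0) &
    forall m, S m = a0 *l: m - m *r: a0 >].

Lemma Innbi_zmod_closed : zmod_closed Innbi.
Proof.
split=> [|f g /asboolP[a0 a0Z fE] /asboolP[b0 b0Z gE]]; apply/asboolP.
- exists 0 => [a|m]; first by rewrite mul0r mulr0.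
  by rewrite lact0l ract0r subrr.
- exists (a0 - b0) => [a|m]; first by rewrite mulrBl mulrBr a0Z b0Z.
  rewrite -[LHS]/(f m - g m) fE gE.
  by rewrite lactDl lactNl ractDr ractNr !opprD !opprK addrACA.
Qed.

HB.instance Definition _ :=
  GRing.isZmodClosed.Build BimodEnd Innbi Innbi_zmod_closed.

Definition H1bimod : zmodType := Quotient.quot Innbi.

Lemma bimod_end_mod_gder (S : BimodEnd) : mod_gder (0 : Der A) S.
Proof.
have /asboolP[SL Sl Sr] := valP S; split=> [//|a m|m a].
- by rewrite Sl lact0l addr0.
- by rewrite Sr ract0r addr0.
Qed.

End Restricted.

Definition exact_at (U : Type) (V : Type) (W : zmodType)
    (f : U -> V) (g : V -> W) : Prop :=
  range f = (g @^-1` [set 0])%classic.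

(* Main.v *)
Require Import Defs.
From HB Require Import structures.
From mathcomp Require Import all_boot all_algebra.
From mathcomp Require Import all_classical.

Set Implicit Arguments.
Unset Strict Implicit.
Unset Printing Implicit Defensive.

Local Open Scope ring_scope.
Local Open Scope quotient_scope.

(** A derivation of the form [(d, S)] is inner by an element [(a0, 0)] exactly
    when [d] is the commutator with [a0] in the algebra and [S] is the
    commutator with the same [a0] in the bimodule ([rinnderP]).  Everything
    follows from this description.

    Projecting to [d] sends inner derivations to inner derivations.  A pair
    [(0, S)] is inner by [(a0, 0)] exactly when [a0] commutes with the whole
    algebra and [S] is the commutator with [a0], that is, when [S] is central
    inner ([end_rder_inner]).  One direction of this equivalence makes the map
    [S |-> (0, S)] descend to the quotients, the other one makes the induced map
    injective.

    For exactness in the middle, let [(d, S)] be such that [d] is the commutator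
    with some [a0].  Then [(d, S)] minus the inner derivation given by [(a0, 0)]
    has the form [(0, S')], and a module generalized 0-derivation [S'] is nothing
    but a bimodule endomorphism, so the class of [(d, S)] is the image of the
    class of [S'] ([inner_base_sub_end]). *)

Import GRing.Theory.

(** * Additive maps induced on quotients *)

Section InducedMap.
Context {U V : zmodType} (P : zmodClosed U) (Q : zmodClosed V).

Lemma quot_pi_eq0 (x : U) : (\pi_(Quotient.quot P) x = 0) <-> x \in P.
Proof.
rewrite -(raddf0 \pi_(Quotient.quot P)) -{2}[x]subr0 Quotient.idealrBE.
by split=> /eqP.
Qed.

Context (f : {additive U -> V}) (fPQ : forall x, x \in P -> f x \in Q).

(** The proof that [f] respects the subgroups is an argument, so that it can be
    read off the term when the additive structure of the map is inferred. *)
Definition quot_map of (forall x, x \in P -> f x \in Q) :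
    Quotient.quot P -> Quotient.quot Q :=
  fun x => \pi_(Quotient.quot Q) (f (repr x)).

Lemma quot_map_pi x :
  quot_map fPQ (\pi_(Quotient.quot P) x) = \pi_(Quotient.quot Q) (f x).
Proof.
apply/eqP; rewrite -Quotient.idealrBE -raddfB; apply: fPQ.
by rewrite Quotient.idealrBE reprK.
Qed.

Lemma quot_map_is_zmod_morphism : zmod_morphism (quot_map fPQ).
Proof.
by elim/quotW=> x; elim/quotW=> y; rewrite -raddfB !quot_map_pi !raddfB.
Qed.

HB.instance Definition _ :=
  GRing.isZmodMorphism.Build (Quotient.quot P) (Quotient.quot Q)
    (quot_map fPQ) quot_map_is_zmod_morphism.

End InducedMap.

(** * The two components of a derivation of the form (d, S) *)

Section Components.
Context {R : comPzRingType} {A : pzAlgType R} {M : bimodType A}.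
Implicit Types (D : rder M) (S : BimodEnd M).

Definition base_fun D (a : A) : A := (D ((a, 0) : trivext M)).1.

Definition rder_mod D (m : M) : M := (D ((0, m) : trivext M)).2.

Lemma rder_components D :
  [/\ derivation (base_fun D), mod_gder (base_fun D) (rder_mod D) &
      forall a m, D (a, m) = (base_fun D a, rder_mod D m)].
Proof.
have /asboolP[d [S [dd dS DE]]] := valP D.
have -> : base_fun D = d by apply/funext=> a; rewrite /base_fun DE.
have -> : rder_mod D = S by apply/funext=> m; rewrite /rder_mod DE.
by [].
Qed.

Lemma base_is_der D : base_fun D \in @is_der R A.
Proof. by apply/asboolP; have [] := rder_components D. Qed.

Definition rder_base D : Der A := MkDer (base_is_der D).

Lemma rder_mod_gder D : mod_gder (rder_base D) (rder_mod D).
Proof. by have [] := rder_components D. Qed.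

Lemma rderE D a m : D (a, m) = (rder_base D a, rder_mod D m).
Proof. by have [] := rder_components D. Qed.

Lemma rder_base_is_zmod_morphism : zmod_morphism rder_base.
Proof. by move=> D D'; apply/val_inj/funext. Qed.

HB.instance Definition _ :=
  GRing.isZmodMorphism.Build (rder M) (Der A) rder_base
    rder_base_is_zmod_morphism.

Lemma rder_mod_is_zmod_morphism : zmod_morphism rder_mod.
Proof. by move=> D D'; apply/funext. Qed.

HB.instance Definition _ :=
  GRing.isZmodMorphism.Build (rder M) (M -> M) rder_mod
    rder_mod_is_zmod_morphism.

Lemma rder_base_pair (d : Der A) (S : M -> M) (dS : mod_gder d S) :
  rder_base (rder_pair dS) = d.
Proof. exact/val_inj/funext. Qed.

Lemma rder_mod_pair (d : Der A) (S : M -> M) (dS : mod_gder d S) :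
  rder_mod (rder_pair dS) = S.
Proof. exact/funext. Qed.

Lemma eq_rder D D' :
  rder_base D = rder_base D' -> rder_mod D = rder_mod D' -> D = D'.
Proof.
move=> Db Dm; apply/val_inj/val_inj/funext => -[a m].
by rewrite -[LHS]/(D (a, m)) -[RHS]/(D' (a, m)) !rderE Db Dm.
Qed.

(** * Inner derivations of the form (d, S) *)

(** The commutator of [(a0, 0)] with [(a, m)] is computed componentwise, because
    the bimodule component of [(a0, 0)] contributes nothing. *)
Lemma rinnderP D :
  D \in rinnder (M := M) <->
  exists a0 : A, (forall a, rder_base D a = a0 * a - a * a0) /\
                 (forall m, rder_mod D m = a0 *l: m - m *r: a0).
Proof.
have adE (a0 a : A) (m : M) :
    ((a0, 0) : trivext M) * (a, m) - ((a, m) : trivext M) * (a0, 0)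
    = (a0 * a - a * a0, a0 *l: m - m *r: a0).
  by congr (_, _); rewrite /= ract0 lact0 addr0 add0r.
split=> [/asboolP[a0 DE]|[a0 [bE mE]]].
  exists a0; split=> [a|m].
    by have := DE (a, 0); rewrite adE rderE => -[].
  by have := DE (0, m); rewrite adE rderE => -[].
by apply/asboolP; exists a0 => -[a m]; rewrite adE rderE bE mE.
Qed.

Lemma rinnder_base D :
  D \in rinnder (M := M) -> rder_base D \in Innder (A := A).
Proof. by move=> /rinnderP[a0 [bE _]]; apply/asboolP; exists a0. Qed.

(** * Bimodule endomorphisms as derivations (0, S) *)

Definition end_rder S : rder M := rder_pair (bimod_end_mod_gder S).

Lemma rder_base_end S : rder_base (end_rder S) = 0.
Proof. exact: rder_base_pair. Qed.

Lemma rder_mod_end S : rder_mod (end_rder S) = S.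
Proof. exact: rder_mod_pair. Qed.

Lemma end_rder_is_zmod_morphism : zmod_morphism end_rder.
Proof.
move=> S S'; apply: eq_rder.
  by rewrite (raddfB rder_base) /= !rder_base_end subr0.
by rewrite (raddfB rder_mod) /= !rder_mod_end.
Qed.

HB.instance Definition _ :=
  GRing.isZmodMorphism.Build (BimodEnd M) (rder M) end_rder
    end_rder_is_zmod_morphism.

(** The element [a0] is central precisely because its commutator is the
    algebra component of [(0, S)], which vanishes. *)
Lemma end_rder_inner S : end_rder S \in rinnder (M := M) <-> S \in Innbi (M := M).
Proof.
rewrite rinnderP rder_base_end rder_mod_end; split.
  move=> [a0 [bE mE]]; apply/asboolP; exists a0 => // a.
  by apply/eqP; rewrite -subr_eq0 -bE.
move=> /asboolP[a0 a0Z mE]; exists a0; split=> // a.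
by rewrite a0Z subrr.
Qed.

Lemma mod_gder_commutator (a0 : A) :
  mod_gder (fun a => a0 * a - a * a0) (fun m : M => a0 *l: m - m *r: a0).
Proof.
split=> [k m n|a m|m a].
- by rewrite lactDr ractDl lactZr ractZl scalerBr opprD addrACA.
- rewrite lactDr lactN lactDl lactNl !lactA lractA.
  by rewrite [RHS]addrC addrA subrK.
- rewrite ractDl ractN ractDr ractNr !ractA lractA.
  by rewrite addrA subrK.
Qed.

Lemma mod_gder0_bimod_hom (S : M -> M) : mod_gder (fun _ : A => 0) S -> bimod_hom S.
Proof.
case=> SL Sl Sr; split=> // [a m|m a].
  by rewrite Sl lact0l addr0.
by rewrite Sr ract0r addr0.
Qed.

(** If the algebra component of [D] is the commutator with [a0], subtracting the
    commutator with [a0] from the bimodule component leaves a generalized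
    derivation over 0, that is, a bimodule endomorphism. *)
Lemma inner_base_sub_end D :
  rder_base D \in Innder (A := A) ->
  exists S : BimodEnd M, D - end_rder S \in rinnder (M := M).
Proof.
move=> /asboolP[a0 bE].
have SP : rder_mod D - (fun m => a0 *l: m - m *r: a0) \in @is_bimod_end R A M.
  apply/asboolP/mod_gder0_bimod_hom.
  have -> : (fun _ : A => 0) = der_fun (rder_base D) - (fun a => a0 * a - a * a0).
    by apply/funext=> a; rewrite -[RHS]/(rder_base D a - _) bE subrr.
  exact: mod_gderB (rder_mod_gder D) (mod_gder_commutator a0).
exists (MkBimodEnd SP); apply/rinnderP; exists a0; split=> [a|m].
  have -> : rder_base (D - end_rder (MkBimodEnd SP)) = rder_base D.
    by rewrite (raddfB rder_base) /= rder_base_end subr0.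
  exact: bE.
rewrite (raddfB rder_mod) /= rder_mod_end.
rewrite -[LHS]/(rder_mod D m - (rder_mod D m - _)).
by rewrite opprB addrC subrK.
Qed.

End Components.

Theorem theorem4p2 (R : comPzRingType) (A : pzAlgType R) (M : bimodType A) :
  exists (piA : {additive h1 M -> H1 A}) (Phi : {additive H1bimod M -> h1 M}),
    [/\ forall (d : Der A) (S : M -> M) (dS : mod_gder d S),
          piA (\pi_(h1 M) (rder_pair dS)) = \pi_(H1 A) d,
        forall S : BimodEnd M,
          Phi (\pi_(H1bimod M) S)
            = \pi_(h1 M) (rder_pair (bimod_end_mod_gder S)),
        exact_at (fun _ : unit => 0 : H1bimod M) Phi &
        exact_at Phi piA].
Proof.
have end_rder_sub S : S \in Innbi (M := M) -> end_rder S \in rinnder (M := M).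
  by move/end_rder_inner.
pose piA : {additive h1 M -> H1 A} := quot_map (@rinnder_base R A M).
pose Phi : {additive H1bimod M -> h1 M} := quot_map end_rder_sub.
have piAE D : piA (\pi_(h1 M) D) = \pi_(H1 A) (rder_base D).
  exact: quot_map_pi.
have PhiE S : Phi (\pi_(H1bimod M) S) = \pi_(h1 M) (end_rder S).
  exact: quot_map_pi.
exists piA, Phi; split=> [d S dS|//||].
- by rewrite piAE rder_base_pair.
- apply/seteqP; split=> x /=; first by move=> [_ _ <-]; rewrite raddf0.
  elim/quotW: x => S; rewrite PhiE => /quot_pi_eq0/end_rder_inner SI.
  by exists tt => //; apply/esym/quot_pi_eq0.
- apply/seteqP; split=> x /=.
    move=> [s _ <-]; elim/quotW: s => S.
    by rewrite PhiE piAE rder_base_end; apply/quot_pi_eq0/rpred0.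
  elim/quotW: x => D; rewrite piAE => /quot_pi_eq0/inner_base_sub_end[S DS].
  exists (\pi_(H1bimod M) S) => //; rewrite PhiE.
  by apply/esym/eqP; rewrite -Quotient.idealrBE.
Qed.
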